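(* Let $h=(s,p):\mathbb{D}\to\Gamma$ be a rational $\Gamma$-inner function of degree $n$. Let $E,D$ be polynomials such that $\deg(E),\deg(D)\le n$, $E^{\sim n}=E$, $D(\lambda)\ne0$ on $\overline{\mathbb{D}}$, $|E(\lambda)|\le2|D(\lambda)|$ on $\overline{\mathbb{D}}$, $s=\dfrac{E}{D}$ on $\overline{\mathbb{D}}$ and $p=\dfrac{D^{\sim n}}{D}$ on $\overline{\mathbb{D}}$. Let $A$ be an outer polynomial such that $$|A(\lambda)|^2=|D(\lambda)|^2-\tfrac14|E(\lambda)|^2\quad\text{for all }\lambda\in\mathbb{T}.$$ Then, for every finite Blaschke product $B$ and every $c\in\mathbb{C}$ with $|c|=1$, $$x=\Big(cB\frac{A}{D},\ \frac{E}{D},\ \frac{D^{\sim n}}{D}\Big)$$ is a rational $\overline{\mathcal{P}}$-inner function.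
   Context: $\mathbb{D}$ is the open unit disc in $\mathbb{C}$, $\mathbb{T}$ the unit circle. $\Gamma=\{(z+w,zw):|z|\le1,|w|\le1\}\subset\mathbb{C}^2$ is the closed symmetrized bidisc, with distinguished boundary $b\Gamma=\{(s,p)\in\mathbb{C}^2:|p|=1,\ |s|\le2,\ s=\overline{s}p\}$. A rational $\Gamma$-inner function is a rational analytic map $h=(s,p):\mathbb{D}\to\Gamma$ that maps $\mathbb{T}$ into $b\Gamma$; its degree is the degree of the finite Blaschke product $p$. $\mathbb{B}^{2\times2}$ is the open unit ball of the complex $2\times2$ matrices in the operator norm. The pentablock is $\mathcal{P}=\{(a_{21},\operatorname{tr}A,\det A): A=[a_{ij}]_{i,j=1}^2\in\mathbb{B}^{2\times2}\}\subset\mathbb{C}^3$, with closure $\overline{\mathcal{P}}$ and distinguished boundary $$b\overline{\mathcal{P}}=\Big\{(a,s,p)\in\mathbb{C}^3: (s,p)\in b\Gamma,\ |a|=\sqrt{1-\tfrac14|s|^2}\Big\}.$$ A rational $\overline{\mathcal{P}}$-inner function is a rational analytic map $x:\mathbb{D}\to\overline{\mathcal{P}}$ (which extends continuously to $\overline{\mathbb{D}}$) that maps $\mathbb{T}$ into $b\overline{\mathcal{P}}$. For a polynomial $g$ of degree at most $n$, $g^{\sim n}(\lambda)=\lambda^n\overline{g(1/\overline{\lambda})}$. A polynomial is outer if it has no zeros in $\mathbb{D}$. *)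

(* Defs.v *)
From HB Require Import structures.
From mathcomp Require Import all_boot all_order all_algebra.
From mathcomp Require Import all_classical all_reals all_analysis.
From mathcomp Require Import complex.

Set Implicit Arguments.
Unset Strict Implicit.
Unset Printing Implicit Defensive.
Import Order.TTheory GRing.Theory Num.Theory.
Import numFieldNormedType.Exports.

Local Open Scope classical_set_scope.
Local Open Scope ring_scope.

(* The topology of R[i] is the one of its modulus [`|z|], as for every
   numFieldType; the copy makes it available without writing R[i]^o. *)
#[warnings="-redundant-canonical-projection"]
HB.instance Definition _ (R : realType) := NormedModule.copy R[i] (R[i]^o).

Section Definitions.
Variable R : realType.
Local Notation C := R[i].

Definition disc : set C := [set z | `|z| < 1].
Definition cdisc : set C := [set z | `|z| <= 1].
Definition circle : set C := [set z | `|z| = 1].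

(* Rational and analytic on the open disc.  The quotient N/Q need not be in
   lowest terms, so Q may have zeros in the disc; holomorphy excludes poles of
   f and determines the values of f at the removable ones. *)
Definition rational_analytic (f : C -> C) : Prop :=
  (exists N Q : {poly C}, Q != 0 /\
     forall z, disc z -> Q.[z] != 0 -> f z = N.[z] / Q.[z]) /\
  (forall z, disc z -> derivable f z 1).

Definition blaschke (n : nat) (f : C -> C) : Prop :=
  exists (c : C) (a : 'I_n -> C),
    [/\ `|c| = 1,
        forall i, `|a i| < 1 &
        forall z, cdisc z ->
          f z = c * \prod_(i < n) ((z - a i) / (1 - (a i)^* * z))].

Definition finite_blaschke (f : C -> C) : Prop := exists n, blaschke n f.

Definition Gamma : set (C * C) :=
  [set sp | exists z w : C,
     [/\ `|z| <= 1, `|w| <= 1 & sp = (z + w, z * w)]].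

Definition bGamma : set (C * C) :=
  [set sp | [/\ `|sp.2| = 1, `|sp.1| <= 2 & sp.1 = (sp.1)^* * sp.2]].

(* An inner map on the disc is represented by a total function of which only
   the values on the closed disc matter; the values on the circle are those of
   the continuous extension. *)
Definition Gamma_inner (h : C -> C * C) : Prop :=
  [/\ rational_analytic (fun z => (h z).1) /\
        rational_analytic (fun z => (h z).2),
      {within cdisc, continuous h},
      forall z, disc z -> Gamma (h z) &
      forall z, circle z -> bGamma (h z)].

Definition Gamma_inner_of_degree (n : nat) (h : C -> C * C) : Prop :=
  Gamma_inner h /\ blaschke n (fun z => (h z).2).

Definition l2norm (v : 'cV[C]_2) : R :=
  Num.sqrt (\sum_(i < 2) (Normc.normc (v i 0)) ^+ 2).

Definition opnorm (A : 'M[C]_2) : R :=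
  sup [set l2norm (A *m v) | v in [set v | l2norm v <= 1]].

Definition pentablock : set (C * C * C) :=
  [set (A 1 0, \tr A, \det A) | A in [set A : 'M[C]_2 | opnorm A < 1]].

(* sqrtC is the nonnegative root here: the radicand is a nonnegative real,
   since |s| <= 2 on bGamma. *)
Definition bpentablock : set (C * C * C) :=
  [set x | bGamma (x.1.2, x.2) /\
           `|x.1.1| = sqrtC (1 - 4^-1 * `|x.1.2| ^+ 2)].

Definition pentablock_inner (x : C -> C * C * C) : Prop :=
  [/\ [/\ rational_analytic (fun z => (x z).1.1),
          rational_analytic (fun z => (x z).1.2) &
          rational_analytic (fun z => (x z).2)],
      {within cdisc, continuous x},
      forall z, disc z -> closure pentablock (x z) &
      forall z, circle z -> bpentablock (x z)].

(* g^{~n}, meant for size g <= n.+1: see conj_revE. *)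
Definition conj_rev (n : nat) (g : {poly C}) : {poly C} :=
  \poly_(i < n.+1) (g`_(n - i))^*.

Lemma conj_revE (n : nat) (g : {poly C}) (z : C) :
  (size g <= n.+1)%N -> z != 0 ->
  (conj_rev n g).[z] = z ^+ n * (g.[(z^*)^-1])^*.
Proof.
move=> sg z0; rewrite horner_poly (horner_coef_wide _ sg) rmorph_sum mulr_sumr.
rewrite (reindex_inj rev_ord_inj) /=; apply: eq_bigr => i _.
have lein : (i <= n)%N by rewrite -ltnS.
rewrite subSS subKn// rmorphM rmorphXn /= fmorphV /=.
have -> : (z^*)^* = z by exact: conjCK.
rewrite exprVn mulrCA; congr (_ * _).
by apply/(canRL (mulfK (expf_neq0 _ z0))); rewrite -exprD subnK.
Qed.

Definition outer (g : {poly C}) : Prop := forall z, disc z -> g.[z] != 0.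

End Definitions.

(* Main.v *)
Require Import Defs.
From mathcomp Require Import all_boot all_order all_algebra.
From mathcomp Require Import all_classical all_reals all_analysis.
From mathcomp Require Import complex.
From mathcomp Require Import ring.
Import Order.TTheory GRing.Theory Num.Theory.
Import numFieldNormedType.Exports.
Local Open Scope classical_set_scope.
Local Open Scope ring_scope.

Set Implicit Arguments.
Unset Strict Implicit.
Unset Printing Implicit Defensive.

(** Rationality, analyticity and continuity on the closed disc are clear, since
every component is a quotient of polynomials whose denominator does not vanish
there ([rational_analytic_quot]), and the values on the circle are in the
distinguished boundary because |B| = 1 there.  What has to be proved is that
(a, s, p) = x(z) lies in the closure of the pentablock for z in the disc.

The test functions are a (1 - |al|^2) / (1 - s al + p al^2) for |al| < 1.  On
the distinguished boundary their modulus is at most 1, because of the identity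
[sqr_norm_pencil], which writes the gap of the squares as a squared modulus.
Along x such a function is a quotient of polynomials without poles on the closed
disc, so the maximum modulus principle ([max_modulus]) carries the bound to the
open disc.

Conversely these bounds produce a matrix ([contractive_mx_of_pencil]).  Let u
and v be the eigenvalues that s and p prescribe, first taken in the open disc.
A disc automorphism f applied to a 2x2 matrix M with these eigenvalues gives an
affine function of M, and so multiplies the entry M 1 0 by the divided
difference of f at u and v; for f(z) = (z - al) / (1 - al^* z) this factor is
(1 - |al|^2) / (1 - s al^* + p al^*^2).  Choose al to be the hyperbolic
midpoint of u and v, so that the new eigenvalues are opposite.  The bound at
al^* says exactly that the new entry has modulus at most 1, and for trace 0 a
contraction with given corner entry and determinant, both of modulus at most 1,
can be written down ([exists_contractive_trace0]).  The inverse automorphism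
maps it to a contraction by von Neumann's inequality, which for these maps is a
computation ([contractive_mobius]).

Eigenvalues on the circle have no midpoint, so the argument is applied to
(a, r s, r^2 p) with 0 < r < 1, which still satisfies all the bounds; scaling
the resulting contraction by r puts it in the open unit ball, and r tends to
1. *)

(** * Bounds on the distinguished boundary *)
Section ClosedFieldAlgebra.
Variable C : numClosedFieldType.
Implicit Types (a s p u v z al : C) (M N : 'M[C]_2).

(** This is det (1 - al M) for every 2x2 matrix M of trace s and determinant
p. *)
Definition pencil s p al : C := 1 - s * al + p * al ^+ 2.

Lemma conj_norm2 z : (`|z| ^+ 2)^* = `|z| ^+ 2.
Proof. by rewrite normCK rmorphM /= conjCK mulrC. Qed.

(** Put s = 2 k w and p = w^2 with |w| = 1, k real, and y = w al; the claim
becomes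
|1 - 2 k y + y^2|^2 = (1 - k^2) (1 - |y|^2)^2 + (2 Re y - k (1 + |y|^2))^2. *)
Lemma sqr_norm_pencil s p al : `|p| = 1 -> s = s^* * p ->
  `|pencil s p al| ^+ 2 = (1 - 4^-1 * `|s| ^+ 2) * (1 - `|al| ^+ 2) ^+ 2
     + `|p * al + al^* - 2^-1 * s * (1 + `|al| ^+ 2)| ^+ 2.
Proof.
move=> p1 sE.
have p0 : p != 0 by rewrite -normr_gt0 p1.
have pJ : p^* = p^-1.
  rewrite -[RHS]mul1r; apply/(canRL (mulfK p0)).
  by rewrite mulrC -normCK p1 expr1n.
rewrite !normCK /pencil.
rewrite !(rmorphD, rmorphB, rmorphM, rmorphXn, rmorph1, rmorphN, fmorphV) /=.
rewrite !conjCK pJ.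
set t := s^* in sE *; set b := al^*; rewrite sE.
by field.
Qed.

(** If both terms of [sqr_norm_pencil] vanish then |s| = 2, and the second one
gives 1 + |al|^2 <= 2 |al|, which fails inside the disc. *)
Lemma pencil_neq0_boundary s p al :
  `|p| = 1 -> `|s| <= 2 -> s = s^* * p -> `|al| < 1 -> pencil s p al != 0.
Proof.
move=> p1 s2 sE al1; rewrite -normr_eq0 -sqrf_eq0 (sqr_norm_pencil _ p1 sE).
have r0 : 0 < 1 - `|al| ^+ 2 by rewrite subr_gt0 expr_lt1.
have S0 : 0 <= 1 - 4^-1 * `|s| ^+ 2.
  rewrite subr_ge0 ler_pdivrMl ?ltr0n// mulr1.
  have -> : 4 = 2 ^+ 2 :> C by rewrite -natrX.
  by rewrite lerXn2r ?nnegrE ?ler0n.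
rewrite paddr_eq0 ?mulr_ge0 ?exprn_ge0 ?(ltW r0)//.
rewrite mulf_eq0 sqrf_eq0 (gt_eqF r0) orbF sqrf_eq0 normr_eq0.
apply/negP => /andP[/eqP e1 /eqP e2].
have s2E : `|s| = 2.
  apply/eqP; rewrite -(@eqrXn2 _ 2) ?ler0n//.
  have -> : `|s| ^+ 2 = 4 * (4^-1 * `|s| ^+ 2) by field.
  have -> : 4^-1 * `|s| ^+ 2 = 1 by move/eqP: e1; rewrite subr_eq0 => /eqP <-.
  by rewrite mulr1 -natrX.
have : `|2^-1 * s * (1 + `|al| ^+ 2)| <= 2 * `|al|.
  move/eqP: e2; rewrite subr_eq0 => /eqP <-.
  rewrite (le_trans (ler_normD _ _))// normrM p1 norm_conjC mul1r.
  by rewrite mulr_natl mulr2n.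
rewrite normrM normrM s2E ger0_norm ?invr_ge0 ?ler0n// mulVf ?pnatr_eq0// mul1r.
rewrite ger0_norm ?addr_ge0 ?exprn_ge0// -subr_le0.
have -> : 1 + `|al| ^+ 2 - 2 * `|al| = (1 - `|al|) ^+ 2 by ring.
by rewrite lt_geF// exprn_gt0// subr_gt0.
Qed.

Lemma le_pencil_boundary a s p al :
  `|p| = 1 -> s = s^* * p -> `|a| ^+ 2 = 1 - 4^-1 * `|s| ^+ 2 ->
  `|al| < 1 -> `|a| * (1 - `|al| ^+ 2) <= `|pencil s p al|.
Proof.
move=> p1 sE aE al1.
have r0 : 0 <= 1 - `|al| ^+ 2 by rewrite subr_ge0 expr_le1 // ltW.
rewrite -(@ler_pXn2r _ 2) ?nnegrE ?mulr_ge0// exprMn aE.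
rewrite (sqr_norm_pencil _ p1 sE).
by rewrite lerDl exprn_ge0.
Qed.

(** * Hyperbolic midpoints *)

(** The equation says that the automorphism of the disc taking al to 0 takes u
and v to opposite points.  With s = u + v and p = u v, write be for the point of
the disc with s = be + be^* p; looking for al as a real multiple of be leaves a
real quadratic equation, whose smaller root is used. *)
Lemma hyperbolic_midpoint u v : `|u| < 1 -> `|v| < 1 ->
  exists2 al, `|al| < 1 &
    (u + v) * (1 + `|al| ^+ 2) = 2 * al + 2 * al^* * (u * v).
Proof.
move=> u1 v1; set s := u + v; set p := u * v.
have uv1 : `|u| * `|v| < 1 by rewrite mulr_ilt1.
have P0 : 0 < 1 - `|p| ^+ 2 by rewrite subr_gt0 expr_lt1 ?normrM ?mulr_ge0.
pose be := (s - s^* * p) / (1 - `|p| ^+ 2).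
have be1 : `|be| < 1.
  rewrite normrM normfV (ger0_norm (ltW P0)) ltr_pdivrMr// mul1r.
  have -> : s - s^* * p = u * (1 - `|v| ^+ 2) + v * (1 - `|u| ^+ 2).
    by rewrite !normCK /s /p rmorphD /=; ring.
  have u0 : 0 <= 1 - `|u| ^+ 2 by rewrite subr_ge0 expr_le1 // ltW.
  have v0 : 0 <= 1 - `|v| ^+ 2 by rewrite subr_ge0 expr_le1 // ltW.
  rewrite (le_lt_trans (ler_normD _ _))// !normrM (ger0_norm u0) (ger0_norm v0).
  rewrite -subr_gt0.
  have -> : 1 - (`|u| * `|v|) ^+ 2 -
     (`|u| * (1 - `|v| ^+ 2) + `|v| * (1 - `|u| ^+ 2))
    = (1 - `|u|) * (1 - `|v|) * (1 - `|u| * `|v|) by ring.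
  by rewrite !mulr_gt0// subr_gt0.
have sE : s = be + be^* * p.
  have beP : be * (1 - `|p| ^+ 2) = s - s^* * p by rewrite divfK ?gt_eqF.
  have beJP : be^* * (1 - `|p| ^+ 2) = s^* - s * p^*.
    have := congr1 (fun z : C => z^*) beP.
    rewrite /= rmorphM rmorphB rmorph1 /= conj_norm2 => ->.
    by clearbody s p; rewrite rmorphB rmorphM /= conjCK.
  apply: (mulIf (lt0r_neq0 P0)).
  transitivity (be * (1 - `|p| ^+ 2) + be^* * (1 - `|p| ^+ 2) * p);
    last by ring.
  by rewrite beP beJP normCK; ring.
pose q := sqrtC (1 - `|be| ^+ 2).
have qE : q ^+ 2 = 1 - `|be| ^+ 2 by rewrite sqrtCK.
have q0 : 0 <= q by rewrite sqrtC_ge0 subr_ge0 expr_le1 // ltW.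
have q1 : 0 < 1 + q by rewrite ltr_wpDr.
have qJ : q^* = q by apply/conj_Creal/ger0_real.
exists (be / (1 + q)).
  rewrite normrM normfV (gtr0_norm q1) ltr_pdivrMr// mul1r.
  by rewrite (lt_le_trans be1)// lerDl.
rewrite normrM normfV (gtr0_norm q1) expr_div_n.
have -> : `|be| ^+ 2 = 1 - q ^+ 2 by rewrite qE; ring.
rewrite rmorphM fmorphV rmorphD rmorph1 /= qJ [in LHS]sE.
by field; rewrite gt_eqF.
Qed.

(** * Contractions of trace zero *)
Definition hnorm2 (x : 'cV[C]_2) : C := \sum_i `|x i 0| ^+ 2.

Definition contractive_mx M := forall x, hnorm2 (M *m x) <= hnorm2 x.

Definition mx2 (a b c d : C) : 'M[C]_2 :=
  \matrix_(i, j) (if i == 0 then if j == 0 then a else b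
                  else if j == 0 then c else d).

Lemma hnorm2_mx2 (a b c d : C) (x : 'cV[C]_2) :
  hnorm2 (mx2 a b c d *m x) =
  `|a * x 0 0 + b * x 1 0| ^+ 2 + `|c * x 0 0 + d * x 1 0| ^+ 2.
Proof.
rewrite /hnorm2 !big_ord_recr big_ord0 /= add0r.
rewrite !mxE !big_ord_recr !big_ord0 /= !add0r !mxE /=.
by congr (`|_ * x _ _ + _ * x _ _| ^+ 2 + `|_ * x _ _ + _ * x _ _| ^+ 2);
  apply/val_inj.
Qed.

Lemma hnorm2E (x : 'cV[C]_2) : hnorm2 x = `|x 0 0| ^+ 2 + `|x 1 0| ^+ 2.
Proof.
rewrite /hnorm2 !big_ord_recr big_ord0 /= add0r.
by congr (`|x _ _| ^+ 2 + `|x _ _| ^+ 2); apply/val_inj.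
Qed.

(** If |p| <= |a|, an antidiagonal matrix works.  Otherwise |a|^2 <= |p|, and
there is a multiple of a unitary matrix by the square root of |p|. *)
Lemma exists_contractive_trace0 a p : `|a| <= 1 -> `|p| <= 1 ->
  exists x b, - x ^+ 2 - a * b = p /\ contractive_mx (mx2 x b a (- x)).
Proof.
move=> a1 p1.
have [pa|ap] : `|p| <= `|a| \/ `|a| <= `|p|.
  by apply/orP; rewrite real_leVge ?normr_real.
  have [a0|a0] := eqVneq a 0.
    exists 0, 0; split.
      have : p == 0 by rewrite -normr_le0 (le_trans pa)// a0 normr0.
      by move/eqP->; rewrite a0; ring.
    move=> x; rewrite hnorm2_mx2 hnorm2E a0.
    by rewrite !(mul0r,oppr0,addr0,normr0) expr0n /= addr0 addr_ge0 ?exprn_ge0.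
  exists 0, (- p / a); split; first by field.
  move=> x; rewrite hnorm2_mx2 hnorm2E !(mul0r,oppr0,addr0,add0r) addrC.
  rewrite !normrM normfV normrN !exprMn lerD// ler_piMl ?exprn_ge0//.
    by rewrite expr_le1.
  by rewrite -exprMn expr_le1 ?divr_ge0// ler_pdivrMr ?normr_gt0// mul1r.
have [p0|p0] := eqVneq p 0.
  have a0 : a = 0 by apply/eqP; rewrite -normr_le0 (le_trans ap)// p0 normr0.
  exists 0, 0; split; first by rewrite a0 p0; ring.
  move=> x; rewrite hnorm2_mx2 hnorm2E a0.
  by rewrite !(mul0r,oppr0,addr0,normr0) expr0n /= addr0 addr_ge0 ?exprn_ge0.
pose r := `|p|; have r0 : 0 < r by rewrite normr_gt0.
have rJ : r^* = r by apply/conj_Creal/ger0_real/ltW.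
(* w is the phase and k the modulus of the diagonal entry, chosen so that both
   rows have squared norm r and are orthogonal. *)
pose w := sqrtC (- p / r); have wE : w ^+ 2 = - p / r by rewrite sqrtCK.
have w1 : w * w^* = 1.
  rewrite -normCK -normrX wE normrM normfV normrN -/r (ger0_norm (ltW r0)).
  by rewrite divff ?gt_eqF.
pose k := sqrtC (r - `|a| ^+ 2).
have k0 : 0 <= k.
  rewrite sqrtC_ge0 subr_ge0 (le_trans _ ap)// expr2 ler_piMl//.
have kJ : k^* = k by apply/conj_Creal/ger0_real.
have kE : k ^+ 2 = r - `|a| ^+ 2 by rewrite sqrtCK.
have pE : p = - w ^+ 2 * r by rewrite wE; field; rewrite gt_eqF.
exists (w * k), (w ^+ 2 * a^*); split.
  by rewrite exprMn kE pE normCK; ring.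
move=> x; rewrite hnorm2_mx2 hnorm2E !normCK.
rewrite !(rmorphD, rmorphM, rmorphN, rmorphXn) /= conjCK kJ.
have -> : (w * k * x 0 0 + w ^+ 2 * a^* * x 1 0) *
  (w^* * k * (x 0 0)^* + w^* ^+ 2 * a * (x 1 0)^*) +
  (a * x 0 0 + - (w * k) * x 1 0) * (a^* * (x 0 0)^* + - (w^* * k) * (x 1 0)^*)
  = ((w * w^*) * k ^+ 2 + a * a^*) * (x 0 0 * (x 0 0)^*)
  + ((w * w^*) ^+ 2 * (a * a^*) + (w * w^*) * k ^+ 2) * (x 1 0 * (x 1 0)^*)
  + k * ((w * w^*) - 1) *
    (a * w^* * x 0 0 * (x 1 0)^* + a^* * w * x 1 0 * (x 0 0)^*)
  by ring.
rewrite w1 subrr mulr0 mul0r addr0 expr1n !mul1r -!normCK kE subrK.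
rewrite subrKC -mulrDr.
by rewrite ler_piMl// addr_ge0 ?exprn_ge0.
Qed.

(** * Disc automorphisms acting on matrices *)
Lemma det_mx2 (a b c d : C) : \det (mx2 a b c d) = a * d - b * c.
Proof.
rewrite (expand_det_row _ 0) !big_ord_recl big_ord0 /cofactor !det_mx11 !mxE /=.
by rewrite expr0 expr1; ring.
Qed.

Lemma tr_mx2 (a b c d : C) : \tr (mx2 a b c d) = a + d.
Proof.
by rewrite /mxtrace !big_ord_recr big_ord0 /= add0r !mxE.
Qed.

Lemma sqr_mx2_trace0 (x b a : C) :
  mx2 x b a (- x) *m mx2 x b a (- x) = (x ^+ 2 + a * b)%:M.
Proof.
apply/matrixP => i j; rewrite !mxE !big_ord_recr big_ord0 /= add0r !mxE /=.
case: i => [[|[|//]] i2]; case: j => [[|[|//]] j2];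
  rewrite /= ?mulr1n ?mulr0n; ring.
Qed.

Lemma hnorm2_mobius (v w : 'cV[C]_2) al :
  hnorm2 (v + al^* *: w) - hnorm2 (w + al *: v)
  = (1 - `|al| ^+ 2) * (hnorm2 v - hnorm2 w).
Proof.
rewrite /hnorm2 -!sumrB mulr_sumr; apply: eq_bigr => i _; rewrite !mxE !normCK.
by rewrite !rmorphD !rmorphM /= conjCK; ring.
Qed.

(** The matrix is (N + al) (1 + al^* N)^-1, made affine in N by the relation
N^2 = - p.  It sends w + al^* N w to N w + al w, so that [hnorm2_mobius]
compares the norms of its argument and of its value. *)
Lemma contractive_mobius (N : 'M[C]_2) p al :
  N *m N = (- p)%:M -> contractive_mx N -> `|al| < 1 ->
  1 + al^* ^+ 2 * p != 0 ->
  contractive_mx ((1 + al^* ^+ 2 * p)^-1 *: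
               ((1 - `|al| ^+ 2) *: N + (al + al^* * p)%:M)).
Proof.
move=> NN cN al1 k0 x.
pose w := (1 + al^* ^+ 2 * p)^-1 *: (x - al^* *: (N *m x)).
have NNx : N *m (N *m x) = - p *: x by rewrite mulmxA NN mul_scalar_mx.
have Nw : N *m w = (1 + al^* ^+ 2 * p)^-1 *: (N *m x + (al^* * p) *: x).
  rewrite /w -scalemxAr mulmxBr -scalemxAr NNx scalerA.
  by rewrite mulrN scaleNr opprK.
have xE : x = w + al^* *: (N *m w).
  rewrite Nw /w; apply/matrixP => i j; rewrite !mxE; set y := \sum_ _ _.
  by field.
have MxE : ((1 + al^* ^+ 2 * p)^-1 *:
    ((1 - `|al| ^+ 2) *: N + (al + al^* * p)%:M)) *m x = N *m w + al *: w.
  rewrite Nw /w -scalemxAl mulmxDl mul_scalar_mx -scalemxAl.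
  move: (N *m x) => y; apply/matrixP => i j; rewrite !mxE normCK.
  by field.
rewrite MxE [X in _ <= hnorm2 X]xE -subr_ge0 hnorm2_mobius mulr_ge0 ?subr_ge0//.
by rewrite expr_le1// ltW.
Qed.

Lemma sqr_norm_mobius u al :
  `|1 - al^* * u| ^+ 2 - `|u - al| ^+ 2 = (1 - `|u| ^+ 2) * (1 - `|al| ^+ 2).
Proof. by rewrite !normCK !(rmorphB, rmorphM, rmorph1) /= conjCK; ring. Qed.

Lemma le_mobius u al : `|u| <= 1 -> `|al| <= 1 -> `|u - al| <= `|1 - al^* * u|.
Proof.
move=> u1 al1; rewrite -(@ler_pXn2r _ 2) ?nnegrE// -subr_ge0 sqr_norm_mobius.
by rewrite mulr_ge0// subr_ge0 expr_le1.
Qed.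

Lemma pencilE u v al : pencil (u + v) (u * v) al = (1 - al * u) * (1 - al * v).
Proof. by rewrite /pencil; ring. Qed.

Lemma linear_factor_neq0 u al : `|u| <= 1 -> `|al| < 1 -> 1 - al * u != 0.
Proof.
move=> u1 al1; rewrite subr_eq0; apply/eqP => /(congr1 Num.norm).
rewrite normr1 normrM => e.
suff : `|al| * `|u| < 1 by rewrite -e ltxx.
by rewrite (le_lt_trans _ al1)// ler_piMr.
Qed.

(** Here a' and p' are the corner entry and determinant that the automorphism
taking al to 0 must produce; applying the inverse automorphism to a contraction
of trace 0 with these data gives M. *)
Lemma contractive_mx_of_pencil a u v : `|u| < 1 -> `|v| < 1 ->
  (forall al, `|al| < 1 ->
     `|a| * (1 - `|al| ^+ 2) <= `|pencil (u + v) (u * v) al|) ->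
  exists M, [/\ contractive_mx M, M 1 0 = a, \tr M = u + v & \det M = u * v].
Proof.
move=> u1 v1 le_a; have [al al1 mid] := hyperbolic_midpoint u1 v1.
have alJ1 : `|al^*| < 1 by rewrite norm_conjC.
have := le_a _ alJ1; rewrite norm_conjC pencilE => {}le_a.
have du := linear_factor_neq0 (ltW u1) alJ1.
have dv := linear_factor_neq0 (ltW v1) alJ1.
have r0 : 0 < 1 - `|al| ^+ 2 by rewrite subr_gt0 expr_lt1.
set d := (1 - al^* * u) * (1 - al^* * v) in le_a.
have d0 : d != 0 by rewrite mulf_neq0.
pose a' := a * (1 - `|al| ^+ 2) / d.
pose p' := ((u - al) / (1 - al^* * u)) * ((v - al) / (1 - al^* * v)).
have a'1 : `|a'| <= 1.
  rewrite !normrM normfV (gtr0_norm r0) ler_pdivrMr ?normr_gt0//.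
  by rewrite mul1r.
have p'1 : `|p'| <= 1.
  rewrite normrM mulr_ile1// normrM normfV ler_pdivrMr ?normr_gt0// mul1r;
    by rewrite le_mobius// ltW.
have [x [b [xb cN]]] := exists_contractive_trace0 a'1 p'1.
set N := mx2 x b a' (- x) in cN.
have NN : N *m N = (- p')%:M.
  by rewrite sqr_mx2_trace0 -xb; congr (_%:M); ring.
have r0' : 1 - `|al| ^+ 2 != 0 by rewrite gt_eqF.
have kE : 1 + al^* ^+ 2 * p' = (1 - `|al| ^+ 2) ^+ 2 / d.
  apply: (mulIf d0); rewrite divfK//.
  have -> : (1 + al^* ^+ 2 * p') * d
     = (1 - `|al| ^+ 2) ^+ 2 + al^* * (2 * al + 2 * al^* * (u * v)
         - (u + v) * (1 + `|al| ^+ 2)).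
    by rewrite normCK /p' /d; field; rewrite du dv.
  by rewrite mid subrr mulr0 addr0.
have k0 : 1 + al^* ^+ 2 * p' != 0.
  by rewrite kE mulf_neq0 ?invr_eq0 ?sqrf_eq0.
have cM := contractive_mobius NN cN al1 k0.
have c0E : al + al^* * p' = (u + v) / 2 * (1 + al^* ^+ 2 * p').
  rewrite kE; apply: (mulIf d0); rewrite -[RHS]mulrA divfK//.
  have -> : (al + al^* * p') * d
     = (u + v) / 2 * (1 - `|al| ^+ 2) ^+ 2 + (1 + `|al| ^+ 2) / 2 *
        (2 * al + 2 * al^* * (u * v) - (u + v) * (1 + `|al| ^+ 2)).
    by rewrite normCK /p' /d; field; rewrite du dv.
  by rewrite mid subrr mulr0 addr0.
have p'E : (1 - `|al| ^+ 2) ^+ 2 * p'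
    = - ((u - v) / 2 * (1 + al^* ^+ 2 * p')) ^+ 2.
  have h1 : (u - al) * (1 - al^* * v) = (u - v) * (1 - `|al| ^+ 2) / 2.
    transitivity ((u - v) * (1 - `|al| ^+ 2) / 2
       + ((u + v) * (1 + `|al| ^+ 2) - (2 * al + 2 * al^* * (u * v))) / 2).
      by rewrite normCK; field.
    by rewrite mid subrr mul0r addr0.
  have h2 : (v - al) * (1 - al^* * u) = - ((u - v) * (1 - `|al| ^+ 2) / 2).
    transitivity (- ((u - v) * (1 - `|al| ^+ 2) / 2)
       + ((u + v) * (1 + `|al| ^+ 2) - (2 * al + 2 * al^* * (u * v))) / 2).
      by rewrite normCK; field.
    by rewrite mid subrr mul0r addr0.
  have p'd : p' = ((u - al) * (1 - al^* * v)) * ((v - al) * (1 - al^* * u))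
                 / d ^+ 2 by rewrite /p' /d; field; rewrite du dv.
  by rewrite kE p'd h1 h2; field.
have ME : (1 - `|al| ^+ 2) *: N + (al + al^* * p')%:M
  = mx2 ((1 - `|al| ^+ 2) * x + (al + al^* * p')) ((1 - `|al| ^+ 2) * b)
        ((1 - `|al| ^+ 2) * a') ((1 - `|al| ^+ 2) * - x + (al + al^* * p')).
  apply/matrixP => i j; rewrite !mxE.
  by case: i => [[|[|//]] i2]; case: j => [[|[|//]] j2];
    rewrite /= ?mulr1n ?mulr0n ?addr0.
rewrite ME in cM.
eexists; split; first exact: cM.
- by rewrite !mxE /= kE /a'; field; rewrite d0.
- by rewrite mxtraceZ tr_mx2 c0E; field.
- rewrite detZ det_mx2.
  transitivity ((1 + al^* ^+ 2 * p')^-1 ^+ 2 * ((al + al^* * p') ^+ 2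
     + (1 - `|al| ^+ 2) ^+ 2 * (- x ^+ 2 - a' * b))); first by ring.
  by rewrite xb p'E c0E; field.
Qed.
End ClosedFieldAlgebra.

(** * The maximum modulus principle for rational functions *)
Section Polynomials.
Variable K : numFieldType.

Lemma derivable_poly (p : {poly K}) (x : K) :
  derivable (horner p : K -> K^o) x 1.
Proof.
elim/poly_ind: p => [|p r ih].
  by rewrite (_ : horner 0 = cst 0)//; apply/funext => y; rewrite horner0.
rewrite (_ : horner _ = horner p * id + cst r); last first.
  by apply/funext => y; rewrite !hornerE.
by apply: derivableD => //; apply: derivableM.
Qed.

Lemma continuous_poly (p : {poly K}) : continuous (horner p : K -> K^o).
Proof.
by move=> x; apply/differentiable_continuous/derivable1_diffP/derivable_poly.
Qed.

Lemma continuous_quot (P Q : {poly K}) (x : K) : Q.[x] != 0 ->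
  {for x, continuous (fun z => P.[z] / Q.[z] : K^o)}.
Proof.
move=> Qx.
have cP : (fun z => P.[z]) @ x --> P.[x] by exact: continuous_poly.
have cQ : (fun z => Q.[z]) @ x --> Q.[x] by exact: continuous_poly.
exact: cvgM cP (cvgV Qx cQ).
Qed.

Lemma derivable_quot (P Q : {poly K}) (x : K) : Q.[x] != 0 ->
  derivable (fun z => P.[z] / Q.[z] : K^o) x 1.
Proof.
move=> Qx; apply: derivableM; first exact: derivable_poly.
by apply: derivableV => //; exact: derivable_poly.
Qed.
End Polynomials.

(** Choose d so that d^m ga has the argument of w; then the perturbation by
t^m d^m ga adds to the modulus more than the error x - ga can remove. *)
Lemma direction_of_increase (C : numClosedFieldType) (w ga : C) (m : nat) :
  (0 < m)%N -> ga != 0 ->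
  exists2 d : C, `|d| = 1 & forall t x, 0 < t -> `|ga - x| < `|ga| ->
    `|w| < `|w + (t * d) ^+ m * x|.
Proof.
move=> m0 ga0; have nga0 : `|ga| != 0 by rewrite normr_eq0.
have [e e1 we] : exists2 e : C, `|e| = 1 & w = `|w| * e.
  have [->|w0] := eqVneq w 0; first by exists 1; rewrite ?normr1// normr0 mul0r.
  exists (w / `|w|); last by rewrite mulrC divfK// normr_eq0.
  by rewrite normrM normfV normr_id divff// normr_eq0.
have [d dE] : exists d : C, d ^+ m * ga = `|ga| * e.
  by exists (m.-root (e * `|ga| / ga)); rewrite rootCK// divfK// mulrC.
have d1 : `|d| = 1.
  apply/eqP; rewrite -(@pexpr_eq1 _ _ m)// -normrX -(inj_eq (mulIf nga0)).
  by rewrite -normrM dE normrM normr_id e1 mulr1 mul1r.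
exists d => // t x t0 xga.
have -> : w + (t * d) ^+ m * x =
   (`|w| + t ^+ m * `|ga|) * e - (t * d) ^+ m * (ga - x).
  by rewrite exprMn mulrDl -we -(mulrA _ `|ga|) -dE; ring.
rewrite (lt_le_trans _ (lerB_dist _ _))// !normrM e1 mulr1 normrX normrM d1.
rewrite mulr1 (gtr0_norm t0) ger0_norm; last first.
  by rewrite addr_ge0 ?mulr_ge0 ?exprn_ge0// ltW.
by rewrite -addrA ltrDl subr_gt0 ltr_pM2l// exprn_gt0.
Qed.

Section ComplexPlane.
Variable R : realType.
Local Notation C := R[i].

Lemma norm_normc (z : C) : `|z| = (Normc.normc z)%:C%C.
Proof. by case: z. Qed.

Lemma continuous_normc : continuous (@Normc.normc R : C -> R).
Proof.
move=> z; apply/(@cvgrPdist_lt _ _ _ (nbhs z)) => e e0.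
apply/(@nbhs_ballP C); exists e%:C%C => /=; first by rewrite ltcR.
move=> x; rewrite /ball /= norm_normc ltcR; apply: le_lt_trans.
have h (u v : C) : Normc.normc u - Normc.normc v <= Normc.normc (u - v).
  by rewrite lerBlDr -lecR rmorphD /= -!norm_normc -lerBlDr lerB_dist.
have hJ : Normc.normc (x - z) = Normc.normc (z - x).
  by apply: complexI; rewrite -!norm_normc distrC.
by rewrite ler_norml h andbT lerNl opprB -hJ h.
Qed.

Lemma continuous_Complex : continuous (fun q : R * R => Complex q.1 q.2 : C).
Proof.
move=> [a b]; apply/cvgrPdist_lt => e e0.
have [r r0 eE] : exists2 r : R, 0 < r & e = r%:C%C.
  exists (complex.Re e); first by move: e0; rewrite ltcE => /andP[].
  by rewrite RRe_real// gtr0_real.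
have h1 : \forall x \near nbhs a, `|a - x| < r / 2.
  have /cvgrPdist_lt : (fun x : R => x) @ a --> a by exact: cvg_id.
  by apply; rewrite divr_gt0.
have h2 : \forall x \near nbhs b, `|b - x| < r / 2.
  have /cvgrPdist_lt : (fun x : R => x) @ b --> b by exact: cvg_id.
  by apply; rewrite divr_gt0.
exists ([set x | `|a - x| < r / 2], [set x | `|b - x| < r / 2]) => //.
move=> [x y] /= [ax byy]; rewrite eE.
suff : `|Complex a b - Complex x y : C| < r%:C%C by [].
have -> : Complex a b - Complex x y
    = Complex (a - x) 0 + Complex 0 (b - y) :> C.
  by apply/eqP; rewrite eq_complex /= addr0 add0r !eqxx.
rewrite (le_lt_trans (ler_normD _ _))// !norm_normc -rmorphD ltcR.
by rewrite /= !expr0n /= addr0 add0r !sqrtr_sqr [r]splitr ltrD.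
Qed.

(** The disc is a closed subset of the image of the square [-1, 1] x [-1, 1]. *)
Lemma compact_cdisc : compact (@cdisc R).
Proof.
have seg : compact (`[(-1 : R), 1] `*` `[(-1 : R), 1]).
  by apply: compact_setX; exact: segment_compact.
pose sq : set C := (fun q : R * R => Complex q.1 q.2 : C) @`
  (`[(-1 : R), 1] `*` `[(-1 : R), 1]).
apply: (@subclosed_compact _ _ sq).
- rewrite (_ : @cdisc R = (@Normc.normc R : C -> R) @^-1` [set x | x <= 1]).
    apply: closed_comp; last exact: closed_le.
    by move=> x _; exact: continuous_normc.
  by apply/seteqP; split => z; rewrite /cdisc /= norm_normc (lecR _ 1).
- apply: continuous_compact seg; apply: continuous_subspaceT.
  exact: continuous_Complex.
- move=> [x y]; rewrite /cdisc /= normc_def (lecR _ 1) /= => h.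
  have {h} : x ^+ 2 + y ^+ 2 <= 1.
    by rewrite -(@ler_sqrt _ _ 1)// sqrtr1.
  move=> h; exists (x, y) => //=; split; by rewrite /= in_itv /= -ler_norml
    -(@expr_le1 _ 2)// real_normK ?num_real// (le_trans _ h)// ?lerDl ?lerDr
    sqr_ge0.
Qed.

(** Let w be the value of P / Q at c.  If P - w Q were not zero it would be
(X - c)^m G with m > 0 and G nonzero at c, so that P / Q = w + (z - c)^m (G / Q)
near c, and the modulus would grow in the direction given by
[direction_of_increase]. *)
Lemma local_max_proportional (P Q : {poly C}) (c : C) (r : C) : 0 < r ->
  (forall z : C, `|z - c| < r -> Q.[z] != 0) ->
  (forall z : C, `|z - c| < r -> `|P.[z] / Q.[z]| <= `|P.[c] / Q.[c]|) ->
  P = (P.[c] / Q.[c]) *: Q.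
Proof.
move=> r0 Q0 maxc; set w := P.[c] / Q.[c].
have Qc : Q.[c] != 0 by apply: Q0; rewrite subrr normr0.
apply/eqP; rewrite -subr_eq0; apply/negPn/negP => H0.
have [m [G + HE]] := multiplicity_XsubC (P - w *: Q) c.
rewrite H0 /= => Gc.
have m0 : (0 < m)%N.
  case: m HE => // HE; exfalso; move: Gc; rewrite expr0 mulr1 in HE.
  by rewrite -HE rootE !hornerE /w divfK// subrr eqxx.
have fE (z : C) : `|z - c| < r ->
    P.[z] / Q.[z] = w + (z - c) ^+ m * (G.[z] / Q.[z]).
  move=> zr; have := congr1 (fun p => p.[z]) HE.
  rewrite !hornerE => e.
  have -> : P.[z] = w * Q.[z] + G.[z] * (z - c) ^+ m by rewrite -e addrC subrK.
  rewrite mulrDl mulfK ?Q0//; congr (w + _).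
  by rewrite mulrAC mulrC mulrA.
pose ga := G.[c] / Q.[c].
have ga0 : ga != 0 by rewrite mulf_neq0 ?invr_eq0.
have nga0 : 0 < `|ga| by rewrite normr_gt0.
have cg : (fun z => G.[z] / Q.[z]) @ c --> ga.
  exact: (@continuous_quot C).
have /(@nbhs_ballP C) [de /= de0 hde] :
    \forall z \near c, `|ga - G.[z] / Q.[z]| < `|ga|.
  by move/(@cvgrPdist_lt _ _ _ (nbhs c)) : cg; apply.
(* t is positive and less than both de and r; a minimum would require
   comparability in the partial order of C. *)
pose t := de * r / (de + r).
have s0 : 0 < de + r by rewrite addr_gt0.
have t0 : 0 < t by rewrite divr_gt0// mulr_gt0.
have tde : t < de by rewrite ltr_pdivrMr// ltr_pM2l// ltrDr.
have tr : t < r by rewrite ltr_pdivrMr// mulrC ltr_pM2l// ltrDl.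
have [d d1 incr] := direction_of_increase w m0 ga0.
pose z := c + t * d.
have zcE : z - c = t * d by rewrite /z addrC addKr.
have zc : `|z - c| = t by rewrite zcE normrM d1 mulr1 gtr0_norm.
have zr : `|z - c| < r by rewrite zc.
have zde : `|ga - G.[z] / Q.[z]| < `|ga|.
  by apply: hde; rewrite /ball /= distrC zc.
by have := maxc z zr; rewrite fE// -/w lt_geF// zcE incr.
Qed.

(** A maximum point of |P / Q| on the closed disc is either on the circle or
inside; in the latter case P / Q is constant, and its value at 1 decides. *)
Lemma max_modulus (P Q : {poly C}) :
  (forall z, cdisc z -> Q.[z] != 0) ->
  (forall z, circle z -> `|P.[z]| <= `|Q.[z]|) ->
  forall z, cdisc z -> `|P.[z]| <= `|Q.[z]|.
Proof.
move=> Q0 PQ z0 z0D.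
have le1 (z : C) : cdisc z -> (`|P.[z] / Q.[z]| <= 1) = (`|P.[z]| <= `|Q.[z]|).
  by move=> zD; rewrite normrM normfV ler_pdivrMr ?mul1r// normr_gt0 Q0.
have [c cD maxc] : exists2 c : C, cdisc c & forall z, cdisc z ->
    `|P.[z] / Q.[z]| <= `|P.[c] / Q.[c]|.
  have [||c] := @compact_EVT_max C R
      (fun z => Normc.normc (P.[z] / Q.[z])) (@cdisc R) _ (@compact_cdisc).
  - by exists 0; rewrite /cdisc /= normr0.
  - rewrite continuous_subspace_in => z /set_mem zD.
    apply: (@continuous_subspaceT_for C) => //.
    have hf : (fun z => P.[z] / Q.[z]) @ z --> P.[z] / Q.[z].
      exact/(@continuous_quot C)/Q0.
    exact: cvg_comp hf (@continuous_normc _).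
  - move=> /set_mem cD maxc; exists c => // z zD.
    by rewrite !norm_normc lecR maxc// inE.
rewrite -le1// (le_trans (maxc _ z0D))//.
have [c1|c1] := eqVneq `|c| 1; first by rewrite le1// PQ.
have {}c1 : `|c| < 1 by rewrite lt_neqAle c1 -/(cdisc c).
have sub (z : C) : `|z - c| < 1 - `|c| -> cdisc z.
  rewrite ltrBrDr => h; rewrite /cdisc /= -(subrK c z).
  by rewrite (le_trans (ler_normD _ _))// ltW.
have PE := @local_max_proportional P Q c (1 - `|c|).
rewrite subr_gt0 in PE; have {}PE := PE c1 (fun z h => Q0 z (sub z h))
  (fun z h => maxc z (sub z h)).
have D1 : cdisc (1 : C) by rewrite /cdisc /= normr1.
have -> : P.[c] / Q.[c] = P.[1] / Q.[1].
  by rewrite [in RHS]PE !hornerE mulfK// Q0.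
by rewrite le1// PQ// /circle /= normr1.
Qed.

End ComplexPlane.

(** * Membership in the closed pentablock *)

(** The filter structure is an explicit argument, because on the topology of C
instance search does not find it after unification has unfolded it. *)
Lemma cvg_triple (T : Type) (U V W : topologicalType) (F : set_system T)
    (FF : Filter F) (f : T -> U) (g : T -> V) (h : T -> W)
    (u : U) (v : V) (w : W) :
  f @ F --> u -> g @ F --> v -> h @ F --> w ->
  (fun x => (f x, g x, h x)) @ F --> (u, v, w).
Proof. by move=> fu gv hw; exact: cvg_pair (cvg_pair fu gv) hw. Qed.

Section Pentablock.
Variable R : realType.
Local Notation C := R[i].

Lemma rational_analytic_quot (f : C -> C) (P Q : {poly C}) :
  (forall z, cdisc z -> Q.[z] != 0) ->
  (forall z, cdisc z -> f z = P.[z] / Q.[z]) ->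
  rational_analytic f /\ {within @cdisc R, continuous f}.
Proof.
move=> Q0 fE; split; first split.
- exists P, Q; split; last by move=> z /ltW zD _; exact: fE.
  apply/eqP => Q00; have := Q0 0; rewrite /cdisc /= normr0 Q00 horner0 eqxx.
  by move=> /(_ ler01).
- move=> z zD; have Qz : Q.[z] != 0 by apply/Q0/ltW.
  apply: near_eq_derivable (@derivable_quot C P Q z Qz).
  apply/(@nbhs_ballP C); exists (1 - `|z|) => /=; first by rewrite subr_gt0.
  move=> y; rewrite /ball /= distrC ltrBrDr => yz; symmetry; apply: fE.
  by rewrite /cdisc /= -(subrK z y) (le_trans (ler_normD _ _))// ltW.
- have : {within @cdisc R, continuous (fun z => P.[z] / Q.[z] : C)}.
    rewrite continuous_subspace_in => z /set_mem zD.
    apply: (@continuous_subspaceT_for C) => //.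
    exact/(@continuous_quot C)/Q0.
  apply: subspace_eq_continuous => z /set_mem zD.
  by symmetry; exact: fE.
Qed.

Lemma blaschke_quot (B : C -> C) : finite_blaschke B ->
  exists P Q : {poly C}, [/\ forall z, cdisc z -> Q.[z] != 0,
    forall z, cdisc z -> B z = P.[z] / Q.[z] &
    forall z, circle z -> `|P.[z]| = `|Q.[z]| ].
Proof.
move=> [n [c [a [c1 a1 BE]]]].
exists (c *: \prod_(i < n) ('X - (a i)%:P)),
  (\prod_(i < n) (1 - (a i)^* *: 'X)).
have QE z : (\prod_(i < n) (1 - (a i)^* *: 'X)).[z]
    = \prod_(i < n) (1 - (a i)^* * z).
  by rewrite horner_prod; apply: eq_bigr => i _; rewrite !hornerE.
have PE z : (\prod_(i < n) ('X - (a i)%:P)).[z] = \prod_(i < n) (z - a i).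
  by rewrite horner_prod; apply: eq_bigr => i _; rewrite !hornerE.
split=> z zD.
- rewrite QE; apply/prodf_neq0 => i _.
  by rewrite linear_factor_neq0// norm_conjC.
- by rewrite hornerZ QE PE BE// prodf_div mulrA.
- rewrite hornerZ QE PE normrM c1 mul1r !normr_prod; apply: eq_bigr => i _.
  apply/eqP; rewrite -(@eqrXn2 _ 2)// -subr_eq0 -opprB oppr_eq0.
  by rewrite sqr_norm_mobius (zD : `|z| = 1) expr1n subrr mul0r.
Qed.

Lemma hnorm2_sum (x : 'cV[C]_2) :
  hnorm2 x = (\sum_i Normc.normc (x i 0) ^+ 2)%:C%C.
Proof.
by rewrite rmorph_sum; apply: eq_bigr => i _; rewrite rmorphXn /= norm_normc.
Qed.

Lemma l2norm_le (x : 'cV[C]_2) (t : R) : 0 <= t ->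
  (l2norm x <= t) = (hnorm2 x <= (t%:C%C) ^+ 2).
Proof.
move=> t0; rewrite hnorm2_sum -rmorphXn /= lecR /l2norm.
have S0 : 0 <= \sum_i Normc.normc (x i 0) ^+ 2.
  by apply: sumr_ge0 => i _; exact: sqr_ge0.
by rewrite -{1}(ger0_norm t0) -sqrtr_sqr ler_sqrt// sqr_ge0.
Qed.

Lemma opnorm_scale_contractive (M : 'M[C]_2) (t : R) :
  0 <= t -> contractive_mx M -> opnorm (t%:C%C *: M) <= t.
Proof.
move=> t0 cM; apply: ge_sup.
  exists (l2norm (t%:C%C *: M *m 0)); exists 0 => //=.
  rewrite l2norm_le// /hnorm2 big1 ?expr1n ?ler01// => i _.
  by rewrite mxE normr0 expr0n.
move=> _ [x /= x1 <-]; rewrite l2norm_le// -scalemxAl.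
rewrite l2norm_le// rmorph1 expr1n in x1.
have -> : hnorm2 (t%:C%C *: (M *m x)) = (t%:C%C) ^+ 2 * hnorm2 (M *m x).
  rewrite /hnorm2 mulr_sumr; apply: eq_bigr => i _.
  by rewrite !mxE normrM exprMn ger0_norm// ler0c.
by rewrite ler_piMr ?exprn_ge0 ?ler0c// (le_trans (cM x)).
Qed.

Lemma pentablock_contractive (M : 'M[C]_2) (r : C) : 0 <= r -> r < 1 ->
  contractive_mx M -> pentablock (r * M 1 0, r * \tr M, r ^+ 2 * \det M).
Proof.
move=> r0 r1 cM; have [t rE] : exists t : R, r = t%:C%C.
  by exists (complex.Re r); rewrite RRe_real// ger0_real.
move: r0 r1; rewrite rE ler0c (ltcR _ 1) => t0 t1.
exists (t%:C%C *: M) => /=; last by rewrite mxE mxtraceZ detZ.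
exact: le_lt_trans (opnorm_scale_contractive t0 cM) t1.
Qed.

Lemma closure_scaling (A : set (C * C * C)) (a s p : C) :
  (forall r, 0 < r -> r < 1 -> A (r * a, r ^+ 2 * s, r ^+ 4 * p)) ->
  closure A (a, s, p).
Proof.
move=> hA.
have cvgX (k : nat) (b : C) : (fun r : C => r ^+ k * b) @ (1 : C) --> b.
  have e : horner (b *: 'X^k) = (fun r : C => r ^+ k * b).
    by apply/funext => r; rewrite hornerZ hornerXn mulrC.
  have := @continuous_poly C (b *: 'X^k) 1.
  by rewrite /continuous_at e expr1n mul1r.
have c3 : (fun r : C => (r ^+ 1 * a, r ^+ 2 * s, r ^+ 4 * p)) @ (1 : C)
    --> (a, s, p).
  exact: (@cvg_triple _ C C C _ (nbhs_filter (1 : C))).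
move=> U /c3 /(@nbhs_ballP C) [de /= de0 sub].
have s0 : 0 < 1 + de by rewrite addr_gt0.
have r0 : 0 < (1 + de)^-1 by rewrite invr_gt0.
have r1 : (1 + de)^-1 < 1 by rewrite invf_lt1// ltrDl.
have {}sub := sub (1 + de)^-1.
(* 1 / (1 + de) is in the open interval (0, 1) and within de of 1. *)
exists ((1 + de)^-1 ^+ 1 * a, (1 + de)^-1 ^+ 2 * s, (1 + de)^-1 ^+ 4 * p).
split; first by rewrite expr1; exact: hA.
apply: sub; rewrite /ball /= gtr0_norm ?subr_gt0//.
have -> : 1 - (1 + de)^-1 = de / (1 + de) by field; rewrite gt_eqF.
by rewrite ltr_pdivrMr// mulrDr mulr1 ltrDl mulr_gt0.
Qed.

(** Replacing s and p by r s and r^2 p turns the bound at al into the one at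
r al, and 1 - |al|^2 <= 1 - |r al|^2; so the hypothesis survives while the
eigenvalues move into the open disc. *)
Lemma closure_pentablock (a s p : C) : Gamma (s, p) ->
  (forall al, `|al| < 1 -> `|a| * (1 - `|al| ^+ 2) <= `|pencil s p al|) ->
  closure (@pentablock R) (a, s, p).
Proof.
move=> [u [v [u1 v1 [-> ->]]]] le_a; apply: closure_scaling => r r0 r1.
have ur : `|r * u| < 1.
  by rewrite normrM (gtr0_norm r0) (le_lt_trans _ r1)// ler_piMr// ltW.
have vr : `|r * v| < 1.
  by rewrite normrM (gtr0_norm r0) (le_lt_trans _ r1)// ler_piMr// ltW.
have [M [cM Ma Ms Mp]] : exists M : 'M[C]_2, [/\ contractive_mx M, M 1 0 = a,
    \tr M = r * u + r * v & \det M = r * u * (r * v)].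
  apply: contractive_mx_of_pencil => // al al1.
  have ral : `|r * al| <= `|al|.
    by rewrite normrM (gtr0_norm r0) ler_piMl// ltW.
  have -> : pencil (r * u + r * v) (r * u * (r * v)) al
     = pencil (u + v) (u * v) (r * al) by rewrite /pencil; ring.
  apply: le_trans (le_a _ (le_lt_trans ral al1)).
  by rewrite ler_wpM2l// lerD2l lerN2 lerXn2r ?nnegrE.
have := pentablock_contractive (ltW r0) r1 cM.
by rewrite Ma Ms Mp; congr pentablock; congr (_, _, _); ring.
Qed.

End Pentablock.

(** * Multiplying the outer function by a finite Blaschke product *)
Theorem theorem7p8 (R : realType) (n : nat) (h : R[i] -> R[i] * R[i])
  (hh : Gamma_inner_of_degree n h)
  (E D : {poly R[i]})
  (degE : (size E <= n.+1)%N) (degD : (size D <= n.+1)%N)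
  (EE : conj_rev n E = E)
  (D0 : forall z, cdisc z -> D.[z] != 0)
  (ED : forall z, cdisc z -> `|E.[z]| <= 2 * `|D.[z]|)
  (sE : forall z, cdisc z -> (h z).1 = E.[z] / D.[z])
  (pD : forall z, cdisc z -> (h z).2 = (conj_rev n D).[z] / D.[z])
  (A : {poly R[i]}) (outerA : outer A)
  (AE : forall z, circle z ->
     `|A.[z]| ^+ 2 = `|D.[z]| ^+ 2 - 4^-1 * `|E.[z]| ^+ 2)
  (B : R[i] -> R[i]) (hB : finite_blaschke B)
  (c : R[i]) (hc : `|c| = 1) :
  pentablock_inner (fun z =>
    (c * B z * (A.[z] / D.[z]), E.[z] / D.[z], (conj_rev n D).[z] / D.[z])).
Proof.
have [[_ _ hG hbG] _] := hh.
move: (conj_rev n D) pD => D' pD.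
have [P [Q [Q0 BE PQ]]] := blaschke_quot hB.
have circle_cdisc z : circle z -> @cdisc R z.
  by rewrite /circle /cdisc /= => ->.
have QD0 z : cdisc z -> (Q * D).[z] != 0.
  by move=> zD; rewrite hornerM mulf_neq0 ?Q0 ?D0.
have aE z : cdisc z ->
    c * B z * (A.[z] / D.[z]) = (c *: (P * A)).[z] / (Q * D).[z].
  by move=> zD; rewrite BE// hornerZ !hornerM; field; rewrite Q0 ?D0.
have [ra ca] := @rational_analytic_quot _
  (fun z => c * B z * (A.[z] / D.[z])) _ _ QD0 aE.
have [rs cs] := @rational_analytic_quot _ (fun z => E.[z] / D.[z]) E D D0
  (fun _ _ => erefl).
have [rp cp] := @rational_analytic_quot _ (fun z => D'.[z] / D.[z]) D' D D0
  (fun _ _ => erefl).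
have hbG' z : circle z -> bGamma (E.[z] / D.[z], D'.[z] / D.[z]).
  move=> zT; rewrite -sE -?pD; [|exact: circle_cdisc..].
  by rewrite -surjective_pairing; exact: hbG.
have hG' z : disc z -> Gamma (E.[z] / D.[z], D'.[z] / D.[z]).
  move=> zD; rewrite -sE -?pD; [|exact: ltW..].
  by rewrite -surjective_pairing; exact: hG.
have aT z : circle z ->
    `|A.[z] / D.[z]| ^+ 2 = 1 - 4^-1 * `|E.[z] / D.[z]| ^+ 2.
  move=> zT; have Dz : `|D.[z]| != 0.
    by rewrite normr_eq0 D0//; exact: circle_cdisc.
  by rewrite !normrM !normfV !exprMn AE//; field.
have BT z : circle z -> `|c * B z| = 1.
  move=> zT; rewrite normrM hc mul1r BE; last exact: circle_cdisc.
  by rewrite normrM normfV PQ// divff// normr_eq0 Q0//; exact: circle_cdisc.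
apply: And4; first exact: And3 ra rs rp.
- move=> z; apply: (@cvg_triple _ R[i] R[i] R[i] _ (nbhs_filter z)).
  + exact: ca.
  + exact: cs.
  + exact: cp.
- move=> z0 z0D; apply: closure_pentablock; first exact: hG'.
  move=> al al1.
  have r0 : 0 <= 1 - `|al| ^+ 2 by rewrite subr_ge0 expr_le1// ltW.
  (* S / D is the pencil along x, so that the test function along x is the
     quotient of c (1 - |al|^2) P A by Q S. *)
  pose S := D - al *: E + al ^+ 2 *: D'.
  have SE z : cdisc z ->
      S.[z] = D.[z] * pencil (E.[z] / D.[z]) (D'.[z] / D.[z]) al.
    move=> zD; rewrite /pencil !(hornerD, hornerN, hornerZ); field.
    exact: D0.
  have pencil0 z : cdisc z -> pencil (E.[z] / D.[z]) (D'.[z] / D.[z]) al != 0.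
    rewrite /cdisc /= le_eqVlt => /predU1P[zT|zD].
      have [p1 s2 sp] := hbG' z zT; exact: pencil_neq0_boundary.
    have [u [v [u1 v1 [-> ->]]]] := hG' z zD.
    by rewrite pencilE mulf_neq0// linear_factor_neq0.
  have QS0 z : cdisc z -> (Q * S).[z] != 0.
    by move=> zD; rewrite hornerM mulf_neq0 ?Q0// SE// mulf_neq0 ?D0 ?pencil0.
  have le_circle z : circle z ->
      `|((c * (1 - `|al| ^+ 2)) *: (P * A)).[z]| <= `|(Q * S).[z]|.
    move=> zT; have zD := circle_cdisc z zT; have [p1 _ sp] := hbG' z zT.
    rewrite hornerZ !hornerM SE// !normrM hc mul1r PQ// mulrCA ler_wpM2l//.
    have := le_pencil_boundary p1 sp (aT z zT) al1.
    rewrite normrM normfV mulrAC ler_pdivrMr ?normr_gt0 ?D0// => le.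
    by rewrite (ger0_norm r0) mulrC [leRHS]mulrC.
  have /ltW z0D' : disc z0 by [].
  have := max_modulus QS0 le_circle z0D'.
  rewrite hornerZ !hornerM SE// aE// hornerZ !hornerM !normrM normfV.
  rewrite (ger0_norm r0).
  rewrite hc !mul1r normrM => le.
  rewrite mulrAC ler_pdivrMr ?mulr_gt0 ?normr_gt0 ?Q0 ?D0// [leLHS]mulrC.
  by rewrite [leRHS]mulrC -mulrA.
- move=> z zT; split=> /=; first exact: hbG'.
  by rewrite normrM BT// mul1r -aT// sqrCK.
Qed.
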